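(* There exists a universal constant $L>0$ such that the following holds. Let $X_1,\dots,X_p$ form a stationary process on the one dimensional torus, i.e. the correlation between $X_i$ and $X_j$ is a function of $|i-j|_p:=|i-j|\wedge(p-|i-j|)$. (1) Let $\omega>0$ and suppose that the correlation matrix of $X$ is $\Psi_1(\omega)$, given by $\mathrm{corr}(X_i,X_j)=\exp(-\omega|i-j|_p)$. If the positive integer $k$ is smaller than $p/\lceil\log(4k)/\omega\rceil$, then $$\inf_{\widehat\theta}\ \sup_{\theta\in\Theta[k,p]}\mathbb{E}_{\theta,\Psi_1(\omega)}\big[l(\widehat\theta,\theta)\big]\ge L\frac{k\sigma^2}{n}\left[1+\log\left(\frac{\left\lfloor p\,\lceil\log(4k)/\omega\rceil^{-1}\right\rfloor}{k}\right)\right].$$ (2) Let $t>0$ and suppose that the correlation matrix of $X$ is $\Psi_2(t)$, given by $\mathrm{corr}(X_i,X_j)=(1+|i-j|_p)^{-t}$. If the positive integer $k$ is smaller than $p/\lceil(4k)^{1/t}-1\rceil$, then $$\inf_{\widehat\theta}\ \sup_{\theta\in\Theta[k,p]}\mathbb{E}_{\theta,\Psi_2(t)}\big[l(\widehat\theta,\theta)\big]\ge L\frac{k\sigma^2}{n}\left[1+\log\left(\frac{\left\lfloor p\,\lceil(4k)^{1/t}-1\rceil^{-1}\right\rfloor}{k}\right)\right].$$ The infima are over all estimators $\widehat\theta$ of $\theta$ based on the $n$ observations.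
   Context: Model: $Y=X\theta+\epsilon$, where $\theta\in\mathbb{R}^p$, the row vector $X=(X_i)_{1\le i\le p}$ is a zero mean Gaussian vector with nonsingular covariance matrix, and $\epsilon$ is a zero mean Gaussian variable with variance $\sigma^2>0$, independent of $X$. One observes $n$ i.i.d. replications of $(Y,X)$; $\mathbb{E}_{\theta,\Psi}$ is the corresponding expectation when $X$ has correlation matrix $\Psi$. The loss is $l(\theta_1,\theta_2):=\mathbb{E}[(X\theta_1-X\theta_2)^2]$. $\Theta[k,p]$ is the set of vectors of $\mathbb{R}^p$ with at most $k$ non-zero coordinates. $\wedge$ denotes the minimum, $\lfloor\cdot\rfloor$ and $\lceil\cdot\rceil$ the lower and upper integer parts. It is assumed that $\Psi_1(\omega)$, respectively $\Psi_2(t)$, is indeed a correlation matrix (which is the case at least when $p$ is odd). *)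

(* Defs.v *)
From HB Require Import structures.
From mathcomp Require Import all_boot all_order all_algebra.
From mathcomp Require Import all_classical all_reals all_analysis.
From mathcomp Require Import measurable_realfun.

Set Implicit Arguments.
Unset Strict Implicit.
Unset Printing Implicit Defensive.

Import Order.TTheory GRing.Theory Num.Theory.
Import numFieldNormedType.Exports.

Local Open Scope classical_set_scope.
Local Open Scope ring_scope.

Section iid.
Context d (T : measurableType d) (R : realType).

Definition tuple_cons n (z : T * n.-tuple T) : n.+1.-tuple T :=
  [the n.+1.-tuple T of z.1 :: z.2].

Lemma measurable_tuple_cons n : measurable_fun [set: T * n.-tuple T] (@tuple_cons n).
Proof. exact: measurable_cons. Qed.

HB.instance Definition _ n :=
  isMeasurableFun.Build _ _ _ _ (@tuple_cons n) (@measurable_tuple_cons n).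

(* The law of n independent draws from mu, i.e. the n-fold product of mu. *)
Fixpoint iid_law (mu : probability T R) (n : nat) : probability (n.-tuple T) R :=
  match n with
  | 0 => dirac [tuple]
  | m.+1 => distribution (mu \x iid_law mu m)%E (@tuple_cons m)
  end.

End iid.

Section gaussian.
Context d (Omega : measurableType d) (R : realType) (P : probability Omega R).

(* Normal law with mean m and standard deviation s; the library's normal_prob
   is not a point mass when s = 0, hence the case distinction. *)
Definition gaussian_law (m s : R) : set R -> \bar R :=
  if s == 0 then dirac m else normal_prob m s.

Definition is_gaussian (m s : R) (Z : Omega -> R) : Prop :=
  forall A : set R, measurable A -> P (Z @^-1` A) = gaussian_law m s A.

Context (p : nat).
Implicit Types (X : 'I_p -> {RV P >-> R}) (theta : 'cV[R]_p).

(* The variable X theta, X being seen as a row vector. *)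
Definition linform X theta : Omega -> R :=
  fun w => \sum_(j < p) X j w * theta j 0.

Definition gaussian_vector X : Prop :=
  forall a : 'cV[R]_p, exists m s : R, is_gaussian m s (linform X a).

Definition covmx X : 'M[R]_p := \matrix_(i, j) fine (covariance P (X i) (X j)).

Definition corrmx X : 'M[R]_p :=
  \matrix_(i, j) (covmx X i j / (Num.sqrt (covmx X i i) * Num.sqrt (covmx X j j))).

Definition joint X : Omega -> p.-tuple R := fun w => [tuple X j w | j < p].

Definition independent_noise X (eps : {RV P >-> R}) : Prop :=
  forall (A : set (p.-tuple R)) (B : set R), measurable A -> measurable B ->
    P (joint X @^-1` A `&` eps @^-1` B) = (P (joint X @^-1` A) * P (eps @^-1` B))%E.

Definition gaussian_linear_model X (eps : {RV P >-> R}) (sigma : R) : Prop :=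
  [/\ gaussian_vector X,
      forall j, ('E_P[X j] = 0)%E,
      covmx X \in unitmx,
      is_gaussian 0 sigma eps
    & independent_noise X eps].

End gaussian.

Section observations.
Context d (Omega : measurableType d) (R : realType) (P : probability Omega R).
Context (p : nat) (X : 'I_p -> {RV P >-> R}) (eps : {RV P >-> R}).

(* The pair (Y, X) with Y = X theta + eps. *)
Definition observation (theta : 'cV[R]_p) : Omega -> R * p.-tuple R :=
  fun w => (linform X theta w + eps w, joint X w).

Lemma measurable_observation (theta : 'cV[R]_p) :
  measurable_fun [set: Omega] (observation theta).
Proof.
apply: measurable_fun_pair.
  apply: measurable_funD => //; apply: measurable_sum => j.
  by apply: measurable_funM.
apply/measurable_fun_tnthP => i.
rewrite (_ : _ \o _ = X i)//.
by apply/funext => w /=; rewrite tnth_mktuple.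
Qed.

HB.instance Definition _ (theta : 'cV[R]_p) :=
  isMeasurableFun.Build _ _ _ _ (observation theta) (measurable_observation theta).

(* The law of n i.i.d. replications of (Y, X) when the parameter is theta. *)
Definition sample_law (n : nat) (theta : 'cV[R]_p) :
    probability (n.-tuple (R * p.-tuple R)) R :=
  iid_law (distribution P (observation theta)) n.

Definition loss (theta1 theta2 : 'cV[R]_p) : \bar R :=
  ('E_P[(fun w => (linform X theta1 w - linform X theta2 w) ^+ 2)%R])%E.

Definition estimator (n : nat) : set (n.-tuple (R * p.-tuple R) -> 'cV[R]_p) :=
  [set that | forall j, measurable_fun setT (fun z => that z j 0)].

Definition risk (n : nat) (that : n.-tuple (R * p.-tuple R) -> 'cV[R]_p)
    (theta : 'cV[R]_p) : \bar R :=
  (\int[sample_law n theta]_z loss (that z) theta)%E.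

Definition sparse (k : nat) : set 'cV[R]_p :=
  [set theta : 'cV[R]_p | (#|[pred j : 'I_p | theta j 0 != 0]%R| <= k)%N].

Definition minimax_risk (n k : nat) : \bar R :=
  ereal_inf [set ereal_sup [set @risk n that theta | theta in sparse k]
            | that in @estimator n].

End observations.

Section torus.
Context (R : realType) (p : nat).

Definition torus_dist (i j : 'I_p) : nat :=
  let d := `|i%:Z - j%:Z|%N in minn d (p - d).

Definition Psi1 (omega : R) : 'M[R]_p :=
  \matrix_(i, j) expR (- omega * (torus_dist i j)%:R).

Definition Psi2 (t : R) : 'M[R]_p :=
  \matrix_(i, j) (1 + (torus_dist i j)%:R) `^ (- t).

End torus.

(* Main.v *)
Require Import Defs.
From HB Require Import structures.
From mathcomp Require Import all_boot all_order all_algebra.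
From mathcomp Require Import all_classical all_reals all_analysis.
From mathcomp Require Import measurable_realfun.
From mathcomp Require Import ring lra zify.

(* Among the p covariates, keep k blocks of N = floor(floor(p/m)/k) covariates
   at mutual torus distance at least m; their mutual correlations are then at
   most 1/(4k), so that on vectors supported there with at most 2k nonzero
   coordinates of equal modulus the loss is at least half the squared Euclidean
   norm (in units of the standard deviations).  The hypotheses activate, in each
   block, one covariate with coefficient r or none, where r^2 is of order
   sigma^2 log(4N)/n.  Projecting an estimator on the nearest hypothesis costs a
   constant factor and makes the loss at least r^2/2 times the number of wrong
   blocks.

   In one block, a change of measure between "covariate j is active" and "none
   is" costs a factor 4N, up to an additive error 3/4 on probabilities.  Since
   the events "the estimator selects j" are disjoint, summing over j shows that
   the block is wrong with probability at least 1/32 on average; averaging over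
   the uniform prior on hypotheses gives a hypothesis with k/32 wrong blocks in
   expectation. *)

Set Implicit Arguments.
Unset Strict Implicit.
Unset Printing Implicit Defensive.

Import Order.TTheory GRing.Theory Num.Theory.
Import numFieldNormedType.Exports.

Local Open Scope classical_set_scope.
Local Open Scope ring_scope.

(** * Lebesgue densities of normal laws and their translates *)

Section density.
Context {R : realType}.
Local Open Scope ereal_scope.
Local Notation mu := lebesgue_measure.

(** The image of Lebesgue measure under the translation agrees with Lebesgue measure on half-open
    intervals, hence everywhere. *)
Lemma ge0_integral_translation (c : R) (f : R -> \bar R) :
  measurable_fun [set: R] f -> (forall r, 0 <= f r) ->
  \int[mu]_x f (x + c)%R = \int[mu]_x f x.
Proof.
move=> mf f0.
have mD : measurable_fun [set: R] (fun x : R => (x + c)%R : measurableTypeR R).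
  exact: measurable_funD.
transitivity (\int[pushforward mu
    (fun x : R => (x + c)%R : measurableTypeR R)]_x f x).
  by rewrite ge0_integral_pushforward// preimage_setT.
apply: eq_measure_integral => A mA _; apply/esym.
apply: lebesgue_measure_unique => //= _ [[a b]] _ <-.
rewrite /pushforward (_ : _ @^-1` _ = `](a - c)%R, (b - c)%R]%classic);
  last first.
  by apply/seteqP; split=> x /=; rewrite !in_itv/= ltrBlDr lerBrDr.
rewrite /= !lebesgue_measure_itv/= !lte_fin ltrD2r; case: ifPn => // _.
by rewrite -!EFinB; congr EFin; ring.
Qed.

(** The Radon-Nikodym derivative and [normal_pdf] have the same integral over every measurable set,
    so they agree almost everywhere. *)
Lemma ge0_integral_normal_prob (m s : R) (f : R -> \bar R) :
  measurable_fun [set: R] f -> (forall r, 0 <= f r) ->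
  \int[normal_prob m s]_x f x = \int[mu]_x (f x * (normal_pdf m s x)%:E).
Proof.
move=> mf f0.
rewrite -(Radon_Nikodym_SigmaFinite.change_of_variables
  (normal_prob_dominates m s))//.
have dom := normal_prob_dominates m s.
apply: ge0_ae_eq_integral => //.
- apply: emeasurable_funM => //.
  exact: measurable_int (Radon_Nikodym_SigmaFinite.f_integrable _).
- apply: emeasurable_funM => //; apply/measurable_EFinP.
  exact: measurable_normal_pdf.
- by move=> x _; rewrite mule_ge0// Radon_Nikodym_SigmaFinite.f_ge0.
- by move=> x _; rewrite mule_ge0// lee_fin normal_pdf_ge0.
apply: ae_eqe_mul2l; apply: integral_ae_eq => //.
- exact: Radon_Nikodym_SigmaFinite.f_integrable.
- by apply/measurable_EFinP; exact: measurable_normal_pdf.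
- by move=> E _ mE; rewrite -Radon_Nikodym_SigmaFinite.f_integral.
Qed.

(** The exponential is the ratio of the densities of the normal laws of means [c] and [0]. *)
Lemma ge0_integral_normal_prob_shift (s c : R) (f : R -> \bar R) :
  s != 0%R -> measurable_fun [set: R] f -> (forall r, 0 <= f r) ->
  \int[normal_prob 0 s]_x f (c + x)%R =
  \int[normal_prob 0 s]_x
    (f x * (expR ((2 * x * c - c ^+ 2) / (2 * s ^+ 2)))%:E).
Proof.
move=> s0 mf f0.
have me : measurable_fun [set: R]
    (fun x : R => (expR ((2 * x * c - c ^+ 2) / (2 * s ^+ 2)))%:E).
  apply/measurable_EFinP/measurableT_comp => //; apply: measurable_funM => //.
  by apply: measurable_funB => //; apply: measurable_funM.
have mfc : measurable_fun [set: R] (fun x : R => f (c + x)%R).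
  by apply: measurableT_comp => //; exact: measurable_funD.
have mfe := emeasurable_funM mf me.
have mpdf : measurable_fun [set: R] (fun x : R => (normal_pdf 0 s x)%:E).
  by apply/measurable_EFinP; exact: measurable_normal_pdf.
have fe0 x : 0 <= f x * (expR ((2 * x * c - c ^+ 2) / (2 * s ^+ 2)))%:E.
  by rewrite mule_ge0.
rewrite !ge0_integral_normal_prob// -[RHS](ge0_integral_translation c).
- apply: eq_integral => x _; rewrite -muleA -EFinM addrC; congr (_ * _%:E).
  rewrite normal_pdfE// /normal_fun mulrCA -expRD; congr (_ * expR _)%R.
  by field.
- exact: emeasurable_funM.
- by move=> r; rewrite mule_ge0// lee_fin normal_pdf_ge0.
Qed.

End density.

(** * Densities and sums under product laws *)

Section iid_density.
Local Open Scope ereal_scope.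
Context d (T : measurableType d) (R : realType).
Implicit Types (mu nu : probability T R) (l q : T -> R).

Lemma measurable_tuple_sum l n : measurable_fun setT l ->
  measurable_fun setT (fun z : n.-tuple T => (\sum_(x <- z) l x)%R).
Proof.
move=> ml; under eq_fun do rewrite big_tuple.
apply: measurable_sum => i.
exact: (measurableT_comp ml (measurable_tnth i)).
Qed.

Lemma ge0_integral_iid_lawS mu n (f : n.+1.-tuple T -> \bar R) :
  measurable_fun setT f -> (forall z, 0 <= f z) ->
  \int[iid_law mu n.+1]_z f z =
  \int[mu]_x \int[iid_law mu n]_z f (tuple_cons (x, z)).
Proof.
move=> mf f0.
rewrite [iid_law mu n.+1]/= ge0_integral_distribution//.
have mfc : measurable_fun setT (f \o @tuple_cons _ T n).
  exact: (measurableT_comp mf (@measurable_tuple_cons _ T n)).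
rewrite (@fubini_tonelli1 _ _ _ _ _ mu (iid_law mu n) _ mfc) //.
by move=> z; exact: f0.
Qed.

(** Densities multiply under products, so log-densities add up: Tonelli peels off the first draw and
    the induction hypothesis treats the others. *)
Lemma ge0_integral_iid_density mu nu l : measurable_fun setT l ->
  (forall f : T -> \bar R, measurable_fun setT f -> (forall x, 0 <= f x) ->
    \int[nu]_x f x = \int[mu]_x (f x * (expR (l x))%:E)) ->
  forall n (f : n.-tuple T -> \bar R), measurable_fun setT f ->
    (forall z, 0 <= f z) ->
  \int[iid_law nu n]_z f z =
  \int[iid_law mu n]_z (f z * (expR (\sum_(x <- z) l x))%:E).
Proof.
move=> ml numu; elim=> [|n IH] f mf f0.
  by apply: eq_integral => z _; rewrite tuple0 big_nil expR0 mule1.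
have mexp : measurable_fun setT
    (fun z : n.-tuple T => (expR (\sum_(x <- z) l x))%:E).
  apply/measurable_EFinP/measurableT_comp => //; exact: measurable_tuple_sum.
have mexpS : measurable_fun setT
    (fun z : n.+1.-tuple T => (expR (\sum_(x <- z) l x))%:E).
  apply/measurable_EFinP/measurableT_comp => //; exact: measurable_tuple_sum.
have mfc : measurable_fun setT (f \o @tuple_cons _ T n).
  exact: (measurableT_comp mf (@measurable_tuple_cons _ T n)).
have mcons x :
    measurable_fun setT (fun z : n.-tuple T => f (tuple_cons (x, z))).
  exact: (measurableT_comp mfc (pair1_measurable x)).
rewrite !ge0_integral_iid_lawS//; last 2 first.
- exact: emeasurable_funM.
- by move=> z; rewrite mule_ge0.
under eq_integral do rewrite IH//.
rewrite numu; last 2 first.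
- pose g (xz : T * n.-tuple T) :=
    f (tuple_cons xz) * (expR (\sum_(y <- xz.2) l y))%:E.
  have mg : measurable_fun setT g.
    apply: (emeasurable_funM mfc).
    exact: (measurableT_comp mexp measurable_snd).
  have g0 xz : 0 <= g xz by rewrite mule_ge0.
  exact: (@measurable_fun_fubini_tonelli_F _ _ _ _ _ (iid_law mu n) g mg g0).
- by move=> x; apply: integral_ge0 => z _; rewrite mule_ge0.
apply: eq_integral => x _; rewrite -ge0_integralZr//; last 2 first.
- exact: emeasurable_funM.
- by move=> z _; rewrite mule_ge0.
apply: eq_integral => z _; rewrite /= big_cons expRD EFinM -muleA.
by rewrite [X in _ * X = _]muleC.
Qed.

Lemma ge0_integral_iid_sum mu q : measurable_fun setT q ->
  (forall x, (0 <= q x)%R) -> forall n,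
  \int[iid_law mu n]_z (\sum_(x <- z) q x)%:E = n%:R%:E * \int[mu]_x (q x)%:E.
Proof.
move=> mq q0; elim=> [|n IH].
  rewrite mul0e integral0_eq// => z _; by rewrite tuple0 big_nil.
have msq m : measurable_fun setT (fun z : m.-tuple T => (\sum_(x <- z) q x)%:E).
  by apply/measurable_EFinP; exact: measurable_tuple_sum.
have sq0 m (z : m.-tuple T) : 0 <= (\sum_(x <- z) q x)%:E.
  by rewrite lee_fin sumr_ge0.
rewrite ge0_integral_iid_lawS//=.
have inner x : \int[iid_law mu n]_z (\sum_(y <- tuple_cons (x, z)) q y)%:E =
    (q x)%:E + n%:R%:E * \int[mu]_x (q x)%:E.
  under eq_integral do rewrite big_cons EFinD.
  rewrite ge0_integralD//=.
  - rewrite IH integral_cst// [X in _ * X + _](_ : _ = 1) ?mule1//.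
    exact: probability_setT.
  - by move=> z _; rewrite lee_fin.
  - exact: msq.
transitivity (\int[mu]_x ((q x)%:E + n%:R%:E * \int[mu]_y (q y)%:E)).
  by apply: eq_integral => x _; exact: inner.
rewrite ge0_integralD//=; last 3 first.
- by move=> x _; rewrite lee_fin.
- exact/measurable_EFinP.
- by move=> x _; rewrite mule_ge0// integral_ge0// => y _; rewrite lee_fin.
rewrite integral_cst// [X in _ + _ * X](_ : _ = 1); last first.
  exact: probability_setT.
by rewrite mule1 -[n.+1]add1n natrD EFinD ge0_muleDl ?mul1e// lee_fin.
Qed.

End iid_density.

(** * The law of the noise *)

Section noise_law.
Context (R : realType).
Local Open Scope ereal_scope.

Definition real_copy : measurableTypeR R -> R := idfun.

HB.instance Definition _ :=
  @isMeasurableFun.Build _ _ _ _ real_copy (@measurable_id _ _ setT).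

(* [normal_prob] is a measure on [measurableTypeR R], a copy of [R] whose
   measurable structure does not unify with the canonical one. *)
Definition noise_law (s : R) : probability R R :=
  distribution (normal_prob 0 s) real_copy.

Lemma ge0_integral_noise_law_shift (s c : R) (f : R -> \bar R) :
  s != 0%R -> measurable_fun [set: R] f -> (forall r, 0 <= f r) ->
  \int[noise_law s]_x f (c + x)%R =
  \int[noise_law s]_x
    (f x * (expR ((2 * x * c - c ^+ 2) / (2 * s ^+ 2)))%:E).
Proof.
move=> s0 mf f0.
have me : measurable_fun [set: R]
    (fun x : R => (expR ((2 * x * c - c ^+ 2) / (2 * s ^+ 2)))%:E).
  apply/measurable_EFinP/measurableT_comp => //; apply: measurable_funM => //.
  by apply: measurable_funB => //; apply: measurable_funM.
rewrite !ge0_integral_distribution//.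
- exact: ge0_integral_normal_prob_shift.
- exact: emeasurable_funM.
- by move=> x; rewrite mule_ge0.
- by apply: measurableT_comp => //; exact: measurable_funD.
Qed.

End noise_law.

(** * Likelihood ratios in the Gaussian linear model *)

Section likelihood.
Local Open Scope ereal_scope.
Context d (Omega : measurableType d) (R : realType) (P : probability Omega R).
Context (p : nat) (X : 'I_p -> {RV P >-> R}) (eps : {RV P >-> R}) (sigma : R).
Hypotheses (sigma0 : (0 < sigma)%R) (geps : is_gaussian P 0 sigma eps)
  (indep : independent_noise X eps).
Implicit Types (theta h : 'cV[R]_p) (n : nat).

Definition lincomb theta (x : p.-tuple R) : R :=
  (\sum_(j < p) tnth x j * theta j 0)%R.

(* The logarithm of the density of one observation under [theta + h] with
   respect to its law under [theta]. *)
Definition loglik theta h (z : R * p.-tuple R) : R :=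
  ((2 * (z.1 - lincomb theta z.2) * lincomb h z.2 - lincomb h z.2 ^+ 2) /
   (2 * sigma ^+ 2))%R.

Lemma measurable_lincomb theta : measurable_fun setT (lincomb theta).
Proof.
by apply: measurable_sum => j; apply: measurable_funM => //;
  exact: measurable_tnth.
Qed.

Lemma lincombD theta h x :
  lincomb (theta + h)%R x = (lincomb theta x + lincomb h x)%R.
Proof. by rewrite -big_split; apply: eq_bigr => j _; rewrite mxE mulrDr. Qed.

Lemma lincomb_joint theta w : lincomb theta (joint X w) = linform X theta w.
Proof. by apply: eq_bigr => j _; rewrite tnth_mktuple. Qed.

Lemma measurable_loglik theta h : measurable_fun setT (loglik theta h).
Proof.
have ml t : measurable_fun setT (fun z : R * p.-tuple R => lincomb t z.2).
  exact: (measurableT_comp (measurable_lincomb t) measurable_snd).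
apply: measurable_funM => //; apply: measurable_funB.
  by apply: measurable_funM => //; apply: measurable_funM => //;
    apply: measurable_funB.
exact: measurable_funX.
Qed.

Lemma measurable_joint : measurable_fun setT (joint X).
Proof.
exact: (measurableT_comp measurable_snd (measurable_observation X eps 0)).
Qed.

HB.instance Definition _ := isMeasurableFun.Build _ _ _ _ _ measurable_joint.

Definition joint_noise w := (joint X w, eps w).

Lemma measurable_joint_noise : measurable_fun setT joint_noise.
Proof. by apply: measurable_fun_pair => //; exact: measurable_joint. Qed.

HB.instance Definition _ :=
  isMeasurableFun.Build _ _ _ _ joint_noise measurable_joint_noise.

(** Independence makes the law of [joint_noise] agree with a product measure on rectangles, hence
    everywhere; Tonelli then integrates the noise out first. *)
Lemma ge0_integral_observation theta (f : R * p.-tuple R -> \bar R) :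
  measurable_fun setT f -> (forall z, 0 <= f z) ->
  \int[distribution P (observation X eps theta)]_z f z =
  \int[distribution P (joint X)]_x \int[noise_law sigma]_e
    f (lincomb theta x + e, x)%R.
Proof.
move=> mf f0.
pose g (xe : p.-tuple R * R) := f (lincomb theta xe.1 + xe.2, xe.1)%R.
have mg : measurable_fun setT g.
  apply: (measurableT_comp mf); apply: measurable_fun_pair => //.
  apply: measurable_funD => //.
  exact: (measurableT_comp (measurable_lincomb theta) measurable_fst).
have g0 z : 0 <= g z by exact: f0.
rewrite ge0_integral_distribution//.
transitivity (\int[distribution P joint_noise]_z g z).
  rewrite ge0_integral_distribution//; apply: eq_integral => w _.
  by rewrite /g /= lincomb_joint.
transitivity (\int[distribution P (joint X) \x noise_law sigma]_z g z).
  apply: eq_measure_integral => A mA _; apply/esym.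
  apply: (@product_measure_unique _ _ _ _ _ (distribution P (joint X))
    (noise_law sigma) (distribution P joint_noise)) => // B C mB mC.
  transitivity (P (joint X @^-1` B `&` eps @^-1` C)); first by [].
  by rewrite indep// geps// /gaussian_law gt_eqF.
by rewrite (@fubini_tonelli1 _ _ _ _ _ (distribution P (joint X))
  (noise_law sigma) _ mg g0).
Qed.

(** Given the covariates [x], adding [h] to the parameter translates the response by [lincomb h x],
    so the one-dimensional shift applies for each fixed [x]. *)
Lemma ge0_integral_observation_shift theta h (f : R * p.-tuple R -> \bar R) :
  measurable_fun setT f -> (forall z, 0 <= f z) ->
  \int[distribution P (observation X eps (theta + h))]_z f z =
  \int[distribution P (observation X eps theta)]_z
    (f z * (expR (loglik theta h z))%:E).
Proof.
move=> mf f0.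
have mfe : measurable_fun setT (fun z => f z * (expR (loglik theta h z))%:E).
  apply: emeasurable_funM => //; apply/measurable_EFinP/measurableT_comp => //.
  exact: measurable_loglik.
have fe0 z : 0 <= f z * (expR (loglik theta h z))%:E by rewrite mule_ge0.
rewrite (ge0_integral_observation _ mf f0) (ge0_integral_observation _ mfe fe0).
apply: eq_integral => x _.
pose g e := f (lincomb theta x + e, x)%R.
have mg : measurable_fun setT g.
  apply: (measurableT_comp mf); apply: measurable_fun_pair => //.
  exact: measurable_funD.
have sigmaN0 : (sigma != 0)%R by rewrite gt_eqF.
transitivity (\int[noise_law sigma]_e g (lincomb h x + e)%R).
  by apply: eq_integral => e _; rewrite /g addrA lincombD.
rewrite (ge0_integral_noise_law_shift _ sigmaN0 mg) => [|e]; last exact: f0.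
by apply: eq_integral => e _; rewrite /loglik/= addrAC subrr add0r.
Qed.

Lemma ge0_integral_sample_shift n theta h
    (f : n.-tuple (R * p.-tuple R) -> \bar R) :
  measurable_fun setT f -> (forall z, 0 <= f z) ->
  \int[sample_law X eps n (theta + h)]_z f z =
  \int[sample_law X eps n theta]_z
    (f z * (expR (\sum_(x <- z) loglik theta h x))%:E).
Proof.
move=> mf f0; apply: ge0_integral_iid_density => //.
  exact: measurable_loglik.
by move=> g mg g0; exact: ge0_integral_observation_shift.
Qed.

(** The residual at [theta] is the residual at [theta + h] plus [lincomb h]; this extra term turns
    into the square. *)
Lemma loglik_recenter theta h z :
  loglik theta h z =
  (loglik (theta + h) h z + lincomb h z.2 ^+ 2 / sigma ^+ 2)%R.
Proof.
by rewrite /loglik lincombD; field; rewrite gt_eqF.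
Qed.

Lemma lossE theta h :
  loss X theta h = \int[P]_w (linform X (theta - h)%R w ^+ 2)%:E.
Proof.
rewrite /loss unlock; apply: eq_integral => w _; congr (_ ^+ 2)%:E.
by rewrite /linform -sumrB; apply: eq_bigr => j _; rewrite !mxE mulrBr.
Qed.

(* [P_(theta+h)(log-likelihood > a)] is bounded by Markov's inequality, twice:
   the log-likelihood is [G + Q] with [Q] of mean [n v / sigma^2] and [exp G]
   of mean one, being the density of the sample under [theta + 2 h]. *)
Lemma sample_law_change n theta h (a v : R)
    (A : set (n.-tuple (R * p.-tuple R))) :
  (0 < a)%R -> loss X h 0 = v%:E -> measurable A ->
  sample_law X eps n (theta + h) A <=
  (expR a)%:E * sample_law X eps n theta A +
  (2 / a * (n%:R * v / sigma ^+ 2) + expR (- (a / 2)))%:E.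
Proof.
move=> a0 lv mA.
pose Q (z : n.-tuple (R * p.-tuple R)) : R :=
  (\sum_(x <- z) lincomb h x.2 ^+ 2 / sigma ^+ 2)%R.
pose G (z : n.-tuple (R * p.-tuple R)) : R :=
  (\sum_(x <- z) loglik (theta + h) h x)%R.
pose S (z : n.-tuple (R * p.-tuple R)) : R :=
  (\sum_(x <- z) loglik theta h x)%R.
have SE z : S z = (G z + Q z)%R.
  by rewrite -big_split; apply: eq_bigr => x _; exact: loglik_recenter.
have mq : measurable_fun setT
    (fun x : R * p.-tuple R => lincomb h x.2 ^+ 2 / sigma ^+ 2)%R.
  apply: measurable_funM => //; apply: measurable_funX.
  exact: (measurableT_comp (measurable_lincomb h) measurable_snd).
have q0 (x : R * p.-tuple R) : (0 <= lincomb h x.2 ^+ 2 / sigma ^+ 2)%R.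
  by rewrite divr_ge0// sqr_ge0.
have mQ : measurable_fun setT Q by exact: measurable_tuple_sum.
have mG : measurable_fun setT G.
  by apply: measurable_tuple_sum; exact: measurable_loglik.
have mS : measurable_fun setT S.
  by apply: measurable_tuple_sum; exact: measurable_loglik.
have Q0 z : (0 <= Q z)%R by apply: sumr_ge0.
(* On [B] the density is at most [expR a], which gives the multiplicative term; the rest of [A]
   gives the additive one. *)
pose B := A `&` [set z | S z <= a]%R.
have mB : measurable B.
  apply: measurableI => //; rewrite -[X in measurable X]setTI.
  exact: measurable_fun_le.
pose nu1 := sample_law X eps n (theta + h).
pose nu0 := sample_law X eps n theta.
have iQ : \int[nu1]_z (Q z)%:E = (n%:R * v / sigma ^+ 2)%:E.
  rewrite ge0_integral_iid_sum// -mulrA EFinM; congr (_ * _).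
  rewrite ge0_integral_distribution; last 2 first.
  - by apply/measurable_EFinP; exact: mq.
  - by move=> y; rewrite lee_fin.
  transitivity (\int[P]_w ((linform X h w ^+ 2)%:E * (sigma ^- 2)%:E)).
    by apply: eq_integral => w _ /=; rewrite lincomb_joint EFinM.
  rewrite ge0_integralZr//.
  - by rewrite EFinM -lv lossE subr0.
  - apply/measurable_EFinP/measurable_funX/measurable_sum => j.
    exact: measurable_funM.
  - by move=> w _; rewrite lee_fin sqr_ge0.
  - by rewrite lee_fin invr_ge0 sqr_ge0.
have mexpG : measurable_fun setT (fun z => (expR (G z))%:E).
  by apply/measurable_EFinP; exact: measurableT_comp.
(* This is the total mass of the law with parameter [theta + h + h], computed from its density under
   [theta + h]. *)
have iG : \int[nu1]_z (expR (G z))%:E = 1.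
  have := @ge0_integral_sample_shift n (theta + h) h (cst 1)
    (measurable_cst _) (fun=> lee01).
  under [X in _ = X]eq_integral do rewrite mul1e.
  move=> <-; rewrite integral_cst// mul1e; exact: probability_setT.
have iB : nu1 B <= (expR a)%:E * nu0 A.
  have -> : nu1 B = \int[nu1]_z (\1_B z)%:E by rewrite integral_indic// setIT.
  have -> : nu0 A = \int[nu0]_z (\1_A z)%:E by rewrite integral_indic// setIT.
  have mA1 : measurable_fun setT (fun z => (\1_A z : R)%:E).
    by apply/measurable_EFinP; exact: measurable_indic.
  have mB1 : measurable_fun setT (fun z => (\1_B z : R)%:E).
    by apply/measurable_EFinP; exact: measurable_indic.
  rewrite ge0_integral_sample_shift// -ge0_integralZl//.
  apply: ge0_le_integral => //.
  - apply: emeasurable_funM => //; apply/measurable_EFinP.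
    exact: measurableT_comp.
  - exact: emeasurable_funM.
  move=> z _; rewrite -!EFinM lee_fin mulrC !indicE /B in_setI.
  case: (z \in A); rewrite /= ?mulr0//.
  case: (boolP (z \in _)) => [|_]; rewrite ?mulr1 ?mulr0 ?expR_ge0//.
  by rewrite inE/= ler_expR.
have mQE : measurable_fun setT (fun z => (Q z)%:E) by exact/measurable_EFinP.
have mQ' : measurable_fun setT (fun z => (2 / a)%:E * (Q z)%:E).
  exact: emeasurable_funM.
have mG' : measurable_fun setT
    (fun z => (expR (- (a / 2)))%:E * (expR (G z))%:E).
  exact: emeasurable_funM.
have a2 : (0 <= 2 / a)%R by rewrite divr_ge0// ltW.
have iT : \int[nu1]_z
    ((2 / a)%:E * (Q z)%:E + (expR (- (a / 2)))%:E * (expR (G z))%:E) =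
    (2 / a * (n%:R * v / sigma ^+ 2) + expR (- (a / 2)))%:E.
  rewrite ge0_integralD//=; last by move=> z _; rewrite mule_ge0// lee_fin.
  rewrite !ge0_integralZl ?lee_fin ?expR_ge0//=;
    last by move=> z _; rewrite lee_fin.
  by rewrite iQ iG mule1 -EFinM -EFinD.
have mC : measurable (A `\` B) by exact: measurableD.
have AB : A `&` B = B by rewrite /B setIA setIid.
have AE : nu1 A = nu1 B + nu1 (A `\` B).
  by rewrite [LHS](@measureDI _ _ _ nu1 _ B)//= AB addeC.
rewrite [leLHS]AE; apply: leeD; first exact: iB.
rewrite -iT -[X in nu1 X]setIT -integral_indic//.
apply: ge0_le_integral => //.
- by apply/measurable_EFinP; exact: measurable_indic.
- exact: emeasurable_funD.
move=> z _; rewrite -!EFinM -EFinD lee_fin -expRD indicE.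
have [|_] := boolP (z \in _); last first.
  by rewrite /= mulr0n addr_ge0 ?expR_ge0// mulr_ge0.
rewrite inE /B => -[Az] /not_andP[//|/negP].
rewrite -ltNge SE => aS /=; rewrite mulr1n.
(* As [G + Q] exceeds [a], one of the two summands is at least [a / 2]; the corresponding term of
   the majorant is then at least one. *)
have [Qa|Qa] := leP (a / 2)%R (Q z).
  rewrite (@le_trans _ _ (2 / a * Q z)%R) ?lerDl ?expR_ge0//.
  by rewrite mulrAC ler_pdivlMr// mul1r mulrC -ler_pdivrMr.
rewrite (@le_trans _ _ (expR (- (a / 2) + G z))%R) ?lerDr//;
  last exact: mulr_ge0.
rewrite -[leLHS]expR0 ler_expR; lra.
Qed.

End likelihood.

(** * Averages over a finite product of states *)

Section resampling.
Context (R : realFieldType) (I T : finType).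
Implicit Types (eta : {ffun I -> T}) (b : I) (t : T).

Definition update eta b t : {ffun I -> T} :=
  [ffun i => if i == b then t else eta i].

Lemma update_same eta b t : update eta b t b = t.
Proof. by rewrite ffunE eqxx. Qed.

Lemma update_update eta b t t' : update (update eta b t) b t' = update eta b t'.
Proof. by apply/ffunP => i; rewrite !ffunE; case: eqP. Qed.

Lemma update_id eta b : update eta b (eta b) = eta.
Proof. by apply/ffunP => i; rewrite ffunE; case: eqP => [->|]. Qed.

(** Exchanging [t] with the coordinate [eta b] is an involution of the pairs [(eta, t)]. Hence a
    uniform average over [eta] may be computed by first averaging over the state of block [b], the
    others being fixed. *)
Lemma sum_update (F : {ffun I -> T} -> R) b :
  \sum_eta \sum_t F (update eta b t) = #|T|%:R * \sum_eta F eta.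
Proof.
rewrite pair_big_dep/=.
pose phi (x : {ffun I -> T} * T) := (update x.1 b x.2, x.1 b).
have phiK : involutive phi.
  by case=> eta t; rewrite /phi/= update_same update_update update_id.
rewrite -(reindex_inj (P := predT) (F := fun x => F x.1) (inv_inj phiK)).
rewrite -(pair_big_dep predT (fun _ _ => true) (fun eta _ => F eta))/=.
under eq_bigr do rewrite sumr_const -mulr_natl.
by rewrite mulr_sumr.
Qed.

Lemma exists_ge_mean (F : {ffun I -> T} -> R) (c : R) (eta0 : {ffun I -> T}) :
  #|{ffun I -> T}|%:R * c <= \sum_eta F eta -> exists eta, c <= F eta.
Proof.
move=> cF; apply: contrapT => /forallNP nc.
have : \sum_eta F eta < \sum_(eta : {ffun I -> T}) c.
  apply: ltr_sum => [|eta _]; last by rewrite ltNge; apply/negP/nc.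
  by apply/hasP; exists eta0; rewrite ?mem_index_enum.
by rewrite sumr_const -mulr_natl ltNge cF.
Qed.

End resampling.

(** * Lower bounds on the probability of misidentifying a block *)

Section testing.
Context d (Z : measurableType d) (R : realType) (N : nat).
Hypothesis N0 : (0 < N)%N.

(** The [N] pairs [(i, false)] all encode the inactive state, so that the uniform law on pairs gives
    it weight one half and each active covariate weight [1 / (2 * N)]. *)
Definition active (t : 'I_N * bool) : option 'I_N :=
  if t.2 then Some t.1 else None.

Lemma measurable_guess (g : Z -> option 'I_N) :
  (forall j, measurable [set z | g z = Some j]) ->
  forall o, measurable [set z | g z != o].
Proof.
move=> mg o; rewrite (_ : [set _ | _] = ~` [set z | g z = o]); last first.
  by apply/seteqP; split => z /= /eqP.
apply: measurableC; case: o => // .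
rewrite (_ : [set _ | _] =
  ~` (\bigcup_(j in [set: 'I_N]) [set z | g z = Some j])).
  by apply: measurableC; apply: fin_bigcup_measurable.
apply/seteqP; split => z /= gz; first by case=> j _ /=; rewrite gz.
by case gzj : (g z) => [j|//]; exfalso; apply: gz; exists j.
Qed.

(* Each alternative [(j, true)] is compared with all the copies [(i, false)] of
   the null hypothesis; the [N] events [g = Some j] being disjoint, the factor
   [4 * N] turns into [4] after summation over [j]. *)
Lemma block_error (pr : 'I_N * bool -> probability Z R) (g : Z -> option 'I_N) :
  (forall j, measurable [set z | g z = Some j]) ->
  (forall i j A, measurable A ->
    (pr (j, true) A <= (4 * N%:R)%:E * pr (i, false) A + (3 / 4)%:E)%E) ->
  N%:R / 16 <= \sum_t fine (pr t [set z | g z != active t]).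
Proof.
move=> mg cmp.
have mgN := measurable_guess mg.
pose D j : set Z := [set z | g z = Some j].
pose E0 i : R := fine (pr (i, false) [set z | g z != None]).
pose E1 j : R := fine (pr (j, true) [set z | g z != Some j]).
pose q i j : R := fine (pr (i, false) (D j)).
have finD t j : pr t (D j) \is a fin_num.
  by rewrite fin_num_measure//; exact: mg.
have -> : \sum_t fine (pr t [set z | g z != active t]) =
    \sum_j E1 j + \sum_i E0 i.
  transitivity (\sum_j \sum_b fine (pr (j, b) [set z | g z != active (j, b)])).
    by rewrite pair_bigA; apply: eq_bigr => -[].
  by rewrite -big_split; apply: eq_bigr => j _; rewrite big_bool.
have E1q i j : 1 / 4 - 4 * N%:R * q i j <= E1 j.
  have -> : E1 j = 1 - fine (pr (j, true) (D j)).
    rewrite /E1 (_ : [set _ | _] = ~` D j); last first.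
      by apply/seteqP; split => z /= /eqP.
    by rewrite (probability_setC _ (mg j)) fineB//; exact: finD.
  have := cmp i j (D j) (mg j).
  rewrite -[X in (X <= _)%E]fineK// -[X in (_ <= _ * X + _)%E]fineK//.
  rewrite -EFinM -EFinD lee_fin -/(q i j); lra.
have E0q i : \sum_j q i j <= E0 i.
  have qE j : (q i j)%:E = pr (i, false) (D j) by rewrite fineK.
  rewrite -lee_fin -sumEFin fineK ?fin_num_measure//.
  under eq_bigr do rewrite qE.
  rewrite -measure_bigsetU_ord//; last first.
    apply/trivIsetP => j j' _ _ /eqP jj'; apply/seteqP; split => // z [gj gj'].
    by apply: jj'; have [] := etrans (esym gj) gj'.
  apply: le_measure; rewrite ?inE; [|exact: mgN|].
    by apply: bigsetU_measurable => j _; exact: mg.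
  by rewrite -bigcup_seq => z [j _ /= ->].
have E00 i : 0 <= E0 i by exact: fine_ge0.
(* For each copy [i] of the null, summing [E1q] over [j] bounds the sum of the [E1 j] below by
   [N / 4 - 4 * N * E0 i]; this is then averaged over [i]. *)
have sE : \sum_(j < N) (1 / 4 - 4 * E0 j) <= \sum_j E1 j.
  have NR : 0 < N%:R :> R by rewrite ltr0n.
  rewrite -(ler_pM2l NR).
  have -> : N%:R * (\sum_j E1 j) = \sum_(i < N) \sum_j E1 j.
    by rewrite sumr_const card_ord mulr_natl.
  rewrite mulr_sumr; apply: ler_sum => i _.
  apply: (@le_trans _ _ (\sum_j (1 / 4 - 4 * N%:R * q i j)));
    last exact: ler_sum.
  rewrite sumrB sumr_const card_ord -mulr_sumr -[_ *+ N]mulr_natl.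
  have : 4 * N%:R * (\sum_j q i j) <= 4 * N%:R * E0 i.
    by rewrite ler_pM2l// mulr_gt0.
  lra.
(* The sum of the [E1 j] plus four times that of the [E0 i] is at least [N / 4], so the plain total
   is at least [N / 16]. *)
move: sE; rewrite sumrB sumr_const card_ord -mulr_sumr -mulr_natl.
have : 0 <= \sum_j E1 j by apply: sumr_ge0 => j _; exact: fine_ge0.
have : 0 <= \sum_j E0 j by apply: sumr_ge0.
lra.
Qed.

End testing.

(** With all blocks but [b] fixed, [block_error] bounds the sum over the [2 * N] states of block [b]
    by [N / 16] from below, that is [1 / 32] on average. Summing over [b] and choosing a hypothesis
    at least as bad as the mean gives the result. *)
Lemma blocks_error d (Z : measurableType d) (R : realType) (N k : nat)
    (pr : {ffun 'I_k -> 'I_N * bool} -> probability Z R)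
    (g : 'I_k -> Z -> option 'I_N) : (0 < N)%N ->
  (forall b j, measurable [set z | g b z = Some j]) ->
  (forall eta b i j A, measurable A ->
    (pr (update eta b (j, true)) A <=
     (4 * N%:R)%:E * pr (update eta b (i, false)) A + (3 / 4)%:E)%E) ->
  exists eta,
    k%:R / 32 <= \sum_b fine (pr eta [set z | g b z != active (eta b)]).
Proof.
move=> N0 mg cmp.
apply: (exists_ge_mean [ffun=> (Ordinal N0, true)]).
rewrite exchange_big/=.
apply: (@le_trans _ _ (\sum_(b < k) #|{ffun 'I_k -> 'I_N * bool}|%:R / 32)).
  by rewrite sumr_const card_ord -[leRHS]mulr_natl mulrCA.
apply: ler_sum => b _.
have NR : 0 < N%:R :> R by rewrite ltr0n.
rewrite -(ler_pM2l (x := #|{: 'I_N * bool}|%:R)); last first.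
  by rewrite card_prod card_ord card_bool ltr0n muln_gt0 N0.
rewrite -(sum_update
  (fun eta => fine (pr eta [set z | g b z != active (eta b)])) b).
have -> : #|{: 'I_N * bool}|%:R * (#|{ffun 'I_k -> 'I_N * bool}|%:R / 32) =
    \sum_(eta : {ffun 'I_k -> 'I_N * bool}) (N%:R / 16) :> R.
  rewrite sumr_const -[RHS]mulr_natl card_prod card_ord card_bool natrM; lra.
apply: ler_sum => eta _; under eq_bigr do rewrite update_same.
by apply: block_error => // *; exact: cmp.
Qed.

(** An option is identified with its indicator vector, zero for [None]; distinct options give
    vectors that differ in some coordinate. *)
Lemma option_dist_ge (R : realDomainType) (N : nat) (o o' : option 'I_N) :
  (o != o')%:R <= \sum_i ((o == Some i)%:R - (o' == Some i)%:R) ^+ 2 :> R.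
Proof.
have nneg (P : pred 'I_N) :
    0 <= \sum_(i | P i) ((o == Some i)%:R - (o' == Some i)%:R) ^+ 2 :> R.
  by apply: sumr_ge0 => i _; exact: sqr_ge0.
have [->|oo'] := eqVneq o o'.
  by apply: sumr_ge0 => i _; exact: sqr_ge0.
case: o o' oo' nneg => [i|] [i'|]// oo' nneg.
- by rewrite (bigD1 i)//= eqxx eq_sym (negbTE oo') subr0 expr1n lerDl.
- by rewrite (bigD1 i)//= eqxx subr0 expr1n lerDl.
- by rewrite (bigD1 i')//= eqxx sub0r sqrrN expr1n lerDl.
Qed.

Lemma option_dist_le2 (R : realDomainType) (N : nat) (o o' : option 'I_N) :
  \sum_i ((o == Some i)%:R - (o' == Some i)%:R) ^+ 2 <= 2 :> R.
Proof.
have le1 (u : option 'I_N) : \sum_i (u == Some i)%:R <= 1 :> R.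
  case: u => [i|]; last by rewrite big1.
  rewrite (bigD1 i)//= eqxx big1 ?addr0// => j /negbTE.
  by rewrite eq_sym => ji; rewrite (inj_eq Some_inj) ji.
rewrite (le_trans _ (lerD (le1 o) (le1 o')))// -big_split.
apply: ler_sum => i _.
by do 2![case: (_ == _)]; rewrite /= ?subrr ?subr0 ?sub0r ?sqrrN ?expr1n ?expr0n
  ?addr0 ?add0r// addr_ge0.
Qed.

(** * The loss as a quadratic form in the correlations *)

Section quadratic_loss.
Context d (Omega : measurableType d) (R : realType) (P : probability Omega R).
Context (p : nat) (X : 'I_p -> {RV P >-> R}).
Hypotheses (mean0 : forall j, ('E_P[X j] = 0)%E)
  (corr1 : forall j, corrmx X j j = 1).
Implicit Types (theta : 'cV[R]_p).

Local Notation s j := (Num.sqrt (covmx X j j)).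

(** Otherwise the square root would be zero, and so would the diagonal correlation, since division
    by zero yields zero. *)
Lemma covmx_gt0 j : 0 < covmx X j j.
Proof.
rewrite ltNge; apply/negP => c0; have := corr1 j.
rewrite mxE ler0_sqrtr// mul0r invr0 mulr0 => /esym/eqP.
by rewrite oner_eq0.
Qed.

Lemma std_gt0 j : 0 < s j.
Proof. by rewrite sqrtr_gt0 covmx_gt0. Qed.

Lemma std_neq0 j : s j != 0.
Proof. by rewrite gt_eqF// std_gt0. Qed.

Lemma covmxE i j : covmx X i j = corrmx X i j * (s i * s j).
Proof. by rewrite [in RHS]mxE divfK// mulf_neq0 ?std_neq0. Qed.

Lemma centered_covariance i j :
  covariance P (X i) (X j) = (\int[P]_w (X i w * X j w)%:E)%E.
Proof.
rewrite unlock !mean0 expectation_def; apply: eq_integral => w _.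
by rewrite /= !subr0.
Qed.

(** [fine] sends infinite values to zero, so the positivity of [covmx X i i] forces the second
    moment to be finite. *)
Lemma integral_sqr i : (\int[P]_w (X i w * X i w)%:E = (covmx X i i)%:E)%E.
Proof.
have := covmx_gt0 i; rewrite mxE centered_covariance.
by case: (integral _ _ _) => //=; rewrite ltxx.
Qed.

Lemma integrableM i j : P.-integrable setT (fun w => (X i w * X j w)%:E).
Proof.
have isqr l : P.-integrable setT (fun w => (X l w * X l w)%:E).
  apply/integrableP; split.
    by apply/measurable_EFinP; exact: measurable_funM.
  rewrite (eq_integral (fun w => (X l w * X l w)%:E)) ?integral_sqr ?ltry//.
  by move=> w _; rewrite gee0_abs// lee_fin -expr2 sqr_ge0.
have mij : measurable_fun setT (fun w => (X i w * X j w)%:E).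
  by apply/measurable_EFinP; exact: measurable_funM.
apply: le_integrable (integrableD measurableT (isqr i) (isqr j)) => // w _ /=.
rewrite lee_fin [leRHS]ger0_norm; last by rewrite addr_ge0// -expr2 sqr_ge0.
rewrite ler_norml; apply/andP; split; nra.
Qed.

Lemma integral_prod i j : (\int[P]_w (X i w * X j w)%:E = (covmx X i j)%:E)%E.
Proof.
rewrite mxE centered_covariance fineK//.
by apply: integrable_fin_num => //; exact: integrableM.
Qed.

(** Absorbing the standard deviations into the coefficients leaves the correlation matrix, on which
    the decay assumption bears. *)
Definition qloss theta theta' : R :=
  \sum_i \sum_j (s i * (theta i 0 - theta' i 0)) *
                (s j * (theta j 0 - theta' j 0)) * corrmx X i j.

Lemma loss_qloss theta theta' : loss X theta theta' = (qloss theta theta')%:E.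
Proof.
rewrite lossE; set h := theta - theta'.
have hE i : h i 0 = theta i 0 - theta' i 0 by rewrite !mxE.
transitivity (\int[P]_w \sum_(i < p) \sum_(j < p)
    (h i 0 * h j 0)%:E * (X i w * X j w)%:E)%E.
  apply: eq_integral => w _; rewrite /linform expr2 big_distrlr/= -sumEFin.
  apply: eq_bigr => i _; rewrite -sumEFin; apply: eq_bigr => j _.
  by rewrite -EFinM; congr EFin; ring.
have iij i j : P.-integrable setT
    (fun w => ((h i 0 * h j 0)%:E * (X i w * X j w)%:E)%E).
  by apply: integrableZl => //; exact: integrableM.
rewrite integral_sum//; last by move=> i; exact: integrable_sum.
rewrite /qloss -sumEFin; apply: eq_bigr => i _.
rewrite integral_sum// -sumEFin; apply: eq_bigr => j _.
rewrite integralZl//; last exact: integrableM.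
by rewrite integral_prod -EFinM covmxE !hE; congr EFin; ring.
Qed.

Lemma qloss_ge0 theta theta' : 0 <= qloss theta theta'.
Proof.
rewrite -lee_fin -loss_qloss lossE integral_ge0// => w _.
by rewrite lee_fin sqr_ge0.
Qed.

Lemma qlossC theta theta' : qloss theta theta' = qloss theta' theta.
Proof. by apply: eq_bigr => i _; apply: eq_bigr => j _; ring. Qed.

(* The parallelogram identity. *)
Lemma qloss_triangle t1 t2 t3 :
  qloss t1 t3 <= 2 * qloss t1 t2 + 2 * qloss t2 t3.
Proof.
suff -> : 2 * qloss t1 t2 + 2 * qloss t2 t3 =
    qloss t1 t3 + qloss (t1 + t3) (t2 + t2) by rewrite lerDl qloss_ge0.
rewrite /qloss !mulr_sumr -!big_split; apply: eq_bigr => i _.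
rewrite !mulr_sumr -!big_split; apply: eq_bigr => j _.
by rewrite /= !mxE; ring.
Qed.

Lemma measurable_qloss d' (Z : measurableType d') (t : Z -> 'cV[R]_p) theta :
  (forall j, measurable_fun setT (fun z => t z j 0)) ->
  measurable_fun setT (fun z => qloss (t z) theta).
Proof.
move=> mt; apply: measurable_sum => i; apply: measurable_sum => j.
by do 2![apply: measurable_funM => //]; apply: measurable_funM => //;
  apply: measurable_funB.
Qed.

(** * The block hypotheses and their separation *)

Section block_design.
Context (k N : nat) (f : 'I_k * 'I_N -> 'I_p) (r : R).
Hypothesis corr_small : forall a a', a != a' ->
  `|corrmx X (f a) (f a')| <= (4 * k%:R)^-1.
Implicit Types (v : 'I_k * 'I_N -> R) (eta : {ffun 'I_k -> 'I_N * bool}).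

(** Dividing by [s j] makes [r] a coefficient in units of standard deviations; the sum transports
    [v] along [f]. *)
Definition design v : 'cV[R]_p :=
  \col_j ((\sum_a (f a == j)%:R * v a) * r / s j).

Definition block_param eta : 'cV[R]_p :=
  design (fun a => (active (eta a.1) == Some a.2)%:R).

Lemma designE v j : design v j 0 = (\sum_a (f a == j)%:R * v a) * r / s j.
Proof. by rewrite [LHS]mxE. Qed.

Lemma qloss_design v v' :
  qloss (design v) (design v') =
  r ^+ 2 * \sum_a \sum_a' (v a - v' a) * (v a' - v' a') * corrmx X (f a) (f a').
Proof.
have uE j : s j * (design v j 0 - design v' j 0) =
    r * \sum_a (f a == j)%:R * (v a - v' a).
  rewrite !designE -mulrBl -mulrBl -sumrB mulrCA mulfV ?std_neq0//.
  by rewrite mulr1 mulrC; congr (_ * _); apply: eq_bigr => a _; rewrite mulrBr.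
have pick (a : 'I_k * 'I_N) (F : 'I_p -> R) :
    \sum_j (f a == j)%:R * F j = F (f a).
  rewrite (bigD1 (f a))//= eqxx mul1r big1 ?addr0// => j /negbTE.
  by rewrite eq_sym => ->; rewrite mul0r.
rewrite /qloss; under eq_bigr do under eq_bigr do rewrite !uE.
transitivity (\sum_i \sum_j \sum_a \sum_a' (f a == i)%:R * ((f a' == j)%:R *
   (r ^+ 2 * ((v a - v' a) * (v a' - v' a') * corrmx X i j)))).
  apply: eq_bigr => i _; apply: eq_bigr => j _.
  rewrite mulrACA -expr2 big_distrlr/= -mulrA mulr_suml mulr_sumr.
  apply: eq_bigr => a _; rewrite mulr_suml mulr_sumr; apply: eq_bigr => a' _.
  by ring.
under eq_bigr do rewrite exchange_big/=.
rewrite exchange_big/= mulr_sumr; apply: eq_bigr => a _.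
under eq_bigr do rewrite exchange_big/=.
rewrite exchange_big/= mulr_sumr; apply: eq_bigr => a' _.
under eq_bigr do rewrite -mulr_sumr.
by rewrite pick pick.
Qed.

(** The differences [v] take values in -1, 0, 1, so [|v a| = v a ^+ 2]. With [q] their sum of
    squares, the diagonal contributes [q] and the other terms at most [q * q / (4 * k)] in absolute
    value. Two hypotheses have at most [2 * k] active covariates in all, so [q <= 2 * k] and at
    least [q / 2] remains; finally [q] dominates the number of distinct blocks. *)
Lemma qloss_block_param eta eta' : (0 < k)%N ->
  r ^+ 2 / 2 * (\sum_b (active (eta b) != active (eta' b))%:R) <=
  qloss (block_param eta) (block_param eta').
Proof.
move=> k0; rewrite qloss_design -mulrA ler_wpM2l ?sqr_ge0//.
set D := \sum_b _.
pose v (a : 'I_k * 'I_N) : R := (active (eta a.1) == Some a.2)%:R -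
  (active (eta' a.1) == Some a.2)%:R.
pose q := \sum_a v a ^+ 2.
have k4 : 0 < 4 * k%:R :> R by rewrite mulr_gt0// ltr0n.
have normv a : `|v a| = v a ^+ 2.
  by rewrite /v; do 2![case: (_ == _)];
    rewrite /= ?subrr ?subr0 ?sub0r ?normrN ?sqrrN ?normr0 ?normr1
      ?expr0n ?expr1n.
have qE : q = \sum_b \sum_i v (b, i) ^+ 2.
  by rewrite pair_bigA; apply: eq_bigr => -[].
have Dq : D <= q.
  rewrite qE; apply: ler_sum => b _.
  exact: (option_dist_ge R (active (eta b))).
have q2k : q <= 2 * k%:R.
  have -> : 2 * k%:R = \sum_(b < k) 2 :> R.
    by rewrite sumr_const card_ord mulr_natr.
  rewrite qE; apply: ler_sum => b _.
  by rewrite (le_trans (option_dist_le2 R (active (eta b)) (active (eta' b)))).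
apply: (@le_trans _ _ (q - q * q / (4 * k%:R))).
  have q0 : 0 <= q by apply: sumr_ge0 => a _; exact: sqr_ge0.
  have : q * q <= q * (2 * k%:R) by rewrite ler_wpM2l.
  move=> qq; rewrite (@le_trans _ _ (q / 2))//; first by rewrite mulrC ler_pM2r.
  rewrite lerBrDr -lerBrDl ler_pdivrMr//; lra.
have -> : q - q * q / (4 * k%:R) = \sum_a \sum_a'
    ((a' == a)%:R * v a ^+ 2 - v a ^+ 2 * v a' ^+ 2 * (4 * k%:R)^-1).
  rewrite [q * q]mulr_suml mulr_suml -sumrB; apply: eq_bigr => a _.
  rewrite sumrB -!mulr_suml -mulr_sumr; congr (_ - _).
  by rewrite (bigD1 a)//= eqxx big1 ?addr0 ?mul1r// => i /negbTE ->.
apply: ler_sum => a _; apply: ler_sum => a' _; rewrite -/(v a) -/(v a').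
(* The minorant also subtracts a nonnegative term on the diagonal, which only lowers it. *)
have [->|aa'] := eqVneq a' a.
  rewrite corr1 mulr1 mul1r expr2 lerBlDr lerDl mulr_ge0 ?invr_ge0 ?(ltW k4)//.
  by rewrite -!expr2 mulr_ge0 ?sqr_ge0.
have : `|v a * v a' * corrmx X (f a) (f a')| <=
    v a ^+ 2 * v a' ^+ 2 * (4 * k%:R)^-1.
  rewrite 2!normrM !normv ler_wpM2l ?corr_small//; last by rewrite eq_sym.
  by rewrite mulr_ge0 ?sqr_ge0.
by rewrite ler_norml mul0r sub0r => /andP[].
Qed.

(** Activating one covariate is a translation of the parameter, the form required by
    [sample_law_change]. *)
Lemma block_param_update eta b i j :
  block_param (update eta b (j, true)) =
  block_param (update eta b (i, false)) + design (fun a => (a == (b, j))%:R).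
Proof.
apply/colP => l; rewrite [RHS]mxE !designE -mulrDl -mulrDl -big_split/=.
congr (_ * _ / _); apply: eq_bigr => -[b' j'] _; rewrite -mulrDr; congr (_ * _).
rewrite /= !ffunE xpair_eqE; case: (b' == b) => /=; last by rewrite addr0.
by rewrite /active/= add0r [Some _ == _]eq_sym.
Qed.

Lemma loss_design_delta a :
  loss X (design (fun a' => (a' == a)%:R)) 0 = (r ^+ 2)%:E.
Proof.
have -> : 0 = design (fun=> 0).
  by apply/colP => j; rewrite designE mxE big1 ?mul0r// => b _; rewrite mulr0.
rewrite loss_qloss qloss_design; congr EFin; rewrite -[RHS]mulr1; congr (_ * _).
rewrite (bigD1 a)//= (bigD1 a)//= eqxx corr1 !subr0 !mul1r.
rewrite !big1 ?addr0// => [b /negbTE ba|b /negbTE ->];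
  last by rewrite !(mulr0, mul0r, subr0).
by rewrite big1// => b' _; rewrite ba subr0 !mul0r.
Qed.

(** Each block contributes at most the covariate [f (b, (eta b).1)] to the support. *)
Lemma sparse_block_param eta : sparse k (block_param eta).
Proof.
apply: (@leq_trans #|[set f (b, (eta b).1) | b in 'I_k]%SET|); last first.
  by rewrite (leq_trans (leq_imset_card _ _))// card_ord.
apply/subset_leq_card/fintype.subsetP => j; rewrite !inE designE => nz.
apply/imsetP; apply: contrapT => nex; move: nz.
rewrite big1 ?mul0r ?eqxx// => -[b i] _ /=.
case: (eqVneq (f (b, i)) j) => [fj|]; last by rewrite mul0r.
case: eqP => [|_]; last by rewrite mulr0.
rewrite /active; case: ifP => // _ [ei]; exfalso; apply: nex; exists b => //.
by rewrite ei fj.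
Qed.

End block_design.

End quadratic_loss.

(** * Measurable selection of a nearest hypothesis *)

Section argmin.
Context d (Z : measurableType d) (R : realType) (H : finType).
Context (l : H -> Z -> R) (eta0 : H).

Definition dominance (z : Z) : {ffun H * H -> bool} :=
  [ffun x => l x.1 z <= l x.2 z].

Definition argmin (z : Z) : H :=
  odflt eta0 [pick eta | [forall eta', dominance z (eta, eta')]].

Lemma argmin_le z eta : l (argmin z) z <= l eta z.
Proof.
rewrite /argmin; case: pickP => [e /forallP/(_ eta)|]; first by rewrite ffunE.
(* A finite family has a minimizer, which contradicts the failure of [pick]. *)
case: (Order.TotalTheory.arg_minP (fun e => l e z) (erefl : xpredT eta0)).
move=> e _ le_e /(_ e) /forallP[eta']; rewrite ffunE; exact: le_e.
Qed.

(* [argmin] is a function of the finitely many comparisons in [dominance]. *)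
Lemma measurable_argmin (A : pred H) :
  (forall eta, measurable_fun setT (l eta)) ->
  measurable [set z | A (argmin z)].
Proof.
move=> ml; pose B (c : {ffun H * H -> bool}) x := [set z | dominance z x = c x].
pose sel (c : {ffun H * H -> bool}) : H :=
  odflt eta0 [pick eta | [forall eta', c (eta, eta')]].
have -> : [set z | A (argmin z)] =
    \bigcup_(c in [set c | A (sel c)]) \bigcap_(x in [set: H * H]) B c x.
  apply/seteqP; split => [z Az|z [c Ac zc] /=]; first by exists (dominance z).
  by rewrite /argmin (_ : dominance z = c)//; apply/ffunP => x; exact: zc.
apply: fin_bigcup_measurable => // c _; apply: fin_bigcap_measurable => // x _.
have mle : measurable [set z | l x.1 z <= l x.2 z].
  by rewrite -[X in measurable X]setTI; exact: measurable_fun_le.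
have [cx|/negbTE cx] := boolP (c x).
  by rewrite (_ : B c x = [set z | l x.1 z <= l x.2 z])//; apply/seteqP;
    split=> z; rewrite /B/= cx ffunE.
rewrite (_ : B c x = ~` [set z | l x.1 z <= l x.2 z]); first exact: measurableC.
by apply/seteqP; split=> z; rewrite /B/= cx ffunE;
  [move=> ->|move=> /negP/negbTE].
Qed.

End argmin.

(** * The minimax bound for a general block design *)

Section minimax.
Context d (Omega : measurableType d) (R : realType) (P : probability Omega R).
Context (p : nat) (X : 'I_p -> {RV P >-> R}) (eps : {RV P >-> R}) (sigma : R).
Hypotheses (sigma0 : 0 < sigma) (geps : is_gaussian P 0 sigma eps)
  (indep : independent_noise X eps) (mean0 : forall j, ('E_P[X j] = 0)%E)
  (corr1 : forall j, corrmx X j j = 1).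

(** The threshold [a = ln (4 * N)] gives the factor [4 * N]. The choice of [r] makes
    [n * r ^+ 2 / sigma ^+ 2 = a / 8], so the first Markov term is [1 / 4]; the second,
    [expR (- (a / 2))], is the inverse square root of [4 * N], at most [1 / 2]. *)
Lemma sample_law_change_design (n k N : nat) (f : 'I_k * 'I_N -> 'I_p)
    (eta : {ffun 'I_k -> 'I_N * bool}) b i j A :
  let r := Num.sqrt (sigma ^+ 2 * ln (4 * N%:R) / (8 * n%:R)) in
  (0 < n)%N -> (0 < N)%N -> measurable A ->
  (sample_law X eps n (block_param X f r (update eta b (j, true))) A <=
   (4 * N%:R)%:E *
     sample_law X eps n (block_param X f r (update eta b (i, false))) A +
   (3 / 4)%:E)%E.
Proof.
move=> r n0 N0 mA.
have N1 : 1 <= N%:R :> R by rewrite ler1n.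
have nR : 0 < n%:R :> R by rewrite ltr0n.
set a := ln (4 * N%:R) in r *.
have a0 : 0 < a by rewrite ln_gt0//; lra.
have ea : expR a = 4 * N%:R by rewrite lnK// posrE; lra.
have r2 : r ^+ 2 = sigma ^+ 2 * a / (8 * n%:R).
  by rewrite sqr_sqrtr// divr_ge0 ?mulr_ge0 ?sqr_ge0// ltW.
rewrite (block_param_update X f r eta b i j).
have H := sample_law_change sigma0 geps indep
  (block_param X f r (update eta b (i, false))) a0
  (loss_design_delta mean0 corr1 f r (b, j)) mA.
apply: (le_trans H).
rewrite ea leeD2l// lee_fin r2.
have -> : 2 / a * (n%:R * (sigma ^+ 2 * a / (8 * n%:R)) / sigma ^+ 2) = 1 / 4.
  by field; rewrite !gt_eqF.
suff : expR (- (a / 2)) <= 1 / 2 by lra.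
rewrite expRN div1r lef_pV2 ?posrE ?expR_gt0//.
rewrite -(@ler_sqr _ _ (expR _)) ?nnegrE ?expR_ge0//.
have -> : expR (a / 2) ^+ 2 = 4 * N%:R.
  by rewrite -ea -expRM_natl; congr expR; field.
lra.
Qed.

(** Each wrong block costs [r ^+ 2 / 8] and [k / 32] of them are expected; the [8] in the
    denominator of [r ^+ 2] leads to [2048 = 8 * 8 * 32]. *)
Lemma minimax_risk_ge (n k N : nat) (f : 'I_k * 'I_N -> 'I_p) :
  (0 < n)%N -> (0 < k)%N -> (0 < N)%N ->
  (forall a a', a != a' -> `|corrmx X (f a) (f a')| <= (4 * k%:R)^-1) ->
  ((k%:R * sigma ^+ 2 / n%:R * ln (4 * N%:R) / 2048)%:E <=
   minimax_risk X eps n k)%E.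
Proof.
move=> n0 k0 N0 corr_small.
pose r := Num.sqrt (sigma ^+ 2 * ln (4 * N%:R) / (8 * n%:R)).
have nR : 0 < n%:R :> R by rewrite ltr0n.
have r2 : r ^+ 2 = sigma ^+ 2 * ln (4 * N%:R) / (8 * n%:R).
  have N1 : 1 <= N%:R :> R by rewrite ler1n.
  have a0 : 0 <= ln (4 * N%:R) :> R by rewrite ln_ge0//; lra.
  by rewrite sqr_sqrtr// divr_ge0// mulr_ge0// sqr_ge0.
apply/ereal_infP => _ [that mthat <-].
pose theta := block_param (k := k) X f r.
pose l eta z := qloss X (that z) (theta eta).
pose eta0 : {ffun 'I_k -> 'I_N * bool} := [ffun=> (Ordinal N0, true)].
have ml eta : measurable_fun setT (l eta) by exact: measurable_qloss.
pose g b z := active (argmin l eta0 z b).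
have mg b j : measurable [set z | g b z = Some j].
  rewrite (_ : [set _ | _] =
    [set z | [pred e : {ffun _} | active (e b) == Some j] (argmin l eta0 z)]).
    exact: measurable_argmin.
  by apply/seteqP; split => z /= /eqP.
have [eta errors] : exists eta, k%:R / 32 <= \sum_b
    fine (sample_law X eps n (theta eta) [set z | g b z != active (eta b)]).
  apply: (blocks_error (pr := fun eta => sample_law X eps n (theta eta))) => //.
  by move=> eta b i j A mA; exact: sample_law_change_design.
have sp : sparse k (theta eta) by exact: sparse_block_param.
apply: (@le_trans _ _ (risk X eps that (theta eta))); last first.
  by apply: ereal_sup_ubound; exists (theta eta).
have mE b : measurable [set z | g b z != active (eta b)].
  exact: measurable_guess.
pose loc b z : R := r ^+ 2 / 8 * \1_[set z | g b z != active (eta b)] z.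
have iloc b : (\int[sample_law X eps n (theta eta)]_z (loc b z)%:E =
    (r ^+ 2 / 8)%:E *
    sample_law X eps n (theta eta) [set z | g b z != active (eta b)])%E.
  under eq_integral do rewrite EFinM.
  rewrite ge0_integralZl//; last 2 first.
  - by apply/measurable_EFinP; exact: measurable_indic.
  - by rewrite lee_fin divr_ge0 ?sqr_ge0.
  by rewrite integral_indic// setIT.
have mloc b : measurable_fun setT (fun z => (loc b z)%:E).
  by apply/measurable_EFinP; exact: measurable_funM.
have loc0 b z : 0 <= loc b z by rewrite mulr_ge0 ?divr_ge0 ?sqr_ge0.
apply: (@le_trans _ _ (\int[sample_law X eps n (theta eta)]_z
    \sum_b (loc b z)%:E))%E.
  rewrite ge0_integral_sum//; last by move=> b z _; rewrite lee_fin.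
  have -> : (\sum_b \int[sample_law X eps n (theta eta)]_z (loc b z)%:E)%E =
      (r ^+ 2 / 8 * \sum_b fine (sample_law X eps n (theta eta)
        [set z | g b z != active (eta b)]))%:E.
    rewrite EFinM -sumEFin ge0_sume_distrr; last first.
      by move=> b _; rewrite lee_fin fine_ge0.
    by apply: eq_bigr => b _; rewrite iloc fineK// fin_num_measure.
  rewrite lee_fin (@le_trans _ _ (r ^+ 2 / 8 * (k%:R / 32)))//; last first.
    by rewrite ler_wpM2l// divr_ge0 ?sqr_ge0.
  rewrite r2 le_eqVlt; apply/orP; left; apply/eqP; field.
  by rewrite gt_eqF.
have lossl z : loss X (that z) (theta eta) = (l eta z)%:E by exact: loss_qloss.
rewrite /risk; under [leRHS]eq_integral do rewrite lossl.
apply: ge0_le_integral => //.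
- by move=> z _; apply: sume_ge0 => b _; rewrite lee_fin.
- exact: emeasurable_sum.
- by apply/measurable_EFinP.
move=> z _; rewrite sumEFin lee_fin.
set te := argmin l eta0 z.
(* The projection [te] is at least as close to the estimator as [eta], so both terms of
   [qloss_triangle] are at most [2 * l eta z]. *)
have dist : qloss X (theta te) (theta eta) <= 4 * l eta z.
  have lt := argmin_le l eta0 z eta.
  have := qloss_triangle mean0 corr1 (theta te) (that z) (theta eta).
  rewrite [qloss X (theta te) (that z)]qlossC -/(l te z) -/(l eta z).
  by rewrite -/te in lt; lra.
have sep := qloss_block_param corr1 r corr_small te eta k0.
have -> : \sum_b loc b z =
    (r ^+ 2 / 2 * \sum_b (active (te b) != active (eta b))%:R) / 4.
  rewrite mulr_sumr mulr_suml; apply: eq_bigr => b _; rewrite /loc indicE.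
  rewrite (_ : (z \in _) = (active (te b) != active (eta b))); first by field.
  by apply/idP/idP; rewrite inE.
lra.
Qed.

End minimax.

(** * Well-separated points on the torus *)

Section torus_design.
Context (p k N m : nat).
Hypotheses (m0 : (0 < m)%N) (kNm : (k * N * m <= p)%N).

Lemma grid_index_lt (a : 'I_k * 'I_N) : (a.1 * N + a.2 < k * N)%N.
Proof.
case: a => b j /=; apply: (@leq_trans (b.+1 * N));
  last by rewrite leq_mul2r ltn_ord orbT.
by rewrite mulSn addnC ltn_add2r ltn_ord.
Qed.

Lemma grid_lt (a : 'I_k * 'I_N) : ((a.1 * N + a.2) * m < p)%N.
Proof. by rewrite (leq_trans _ kNm)// ltn_pmul2r// grid_index_lt. Qed.

Definition grid (a : 'I_k * 'I_N) : 'I_p := Ordinal (grid_lt a).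

(** Distinct multiples of [m] are at least [m] apart on the direct arc. All [k * N] cells of length
    [m] fit in [p], so the arc through the origin also has length at least [m]. *)
Lemma torus_dist_grid a a' : a != a' -> (m <= torus_dist (grid a) (grid a'))%N.
Proof.
move=> aa'.
have neq : (a.1 * N + a.2 != a'.1 * N + a'.2)%N.
  apply: contra aa'; case: a a' => b j [b' j'] /= /eqP e.
  have N0 : (0 < N)%N by case: j {e} => j; case: N.
  (* Euclidean division by [N] recovers the block and the position inside it. *)
  apply/eqP; congr pair; apply: val_inj => /=.
    by have := congr1 (divn^~ N) e; rewrite !divnMDl// !divn_small// !addn0.
  by have := congr1 (modn^~ N) e; rewrite !modnMDl !modn_small.
have := grid_index_lt a; have := grid_index_lt a'; move: kNm.
rewrite /torus_dist /=; move: neq.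
move: (a.1 * N + a.2)%N (a'.1 * N + a'.2)%N (k * N)%N => x y K.
move=> xy Kp yK xK.
wlog lt_xy : x y xy yK xK / (x < y)%N => [H|].
  have [xy'|yx|xye] := ltngtP x y; first exact: H.
    by rewrite distnC; apply: H => //; rewrite eq_sym.
  by rewrite xye eqxx in xy.
have -> : `|(x * m)%:Z - (y * m)%:Z|%N = ((y - x) * m)%N.
  by rewrite distnC distnEl ?leq_mul2r ?(ltnW lt_xy) ?orbT// mulnBl.
rewrite leq_min leq_pmull ?subn_gt0//= leq_subRL; last first.
  rewrite (leq_trans _ Kp)// leq_mul2r.
  by rewrite (leq_trans (leq_subr _ _)) ?orbT// ltnW.
rewrite -mulSnr (leq_trans _ Kp)// leq_mul2r; apply/orP; right.
by rewrite -subSn ?(ltnW lt_xy)// (leq_trans (leq_subr _ _)).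
Qed.

Lemma torus_distii (i : 'I_p) : torus_dist i i = 0%N.
Proof. by rewrite /torus_dist distnn min0n. Qed.

End torus_design.

(** * Integer parts and logarithms *)

Lemma floor_divn (R : realType) (p m : nat) : (0 < m)%N ->
  Num.floor (p%:R / m%:R : R) = (p %/ m)%N%:Z.
Proof.
move=> m0; apply: floor_def; have mR : 0 < m%:R :> R by rewrite ltr0n.
rewrite intrD -!pmulrn mulr1n natr1 ler_pdivlMr// ltr_pdivrMr// -!natrM.
by rewrite ler_nat ltr_nat leq_trunc_div ltn_ceil.
Qed.

(** Since [M / k < N + 1 <= 2 * N], the logarithm on the left is at most [ln (2 * N)]; the constant
    [1] is absorbed by [2 * ln 2]. *)
Lemma ln_ratio_le (R : realType) (M k : nat) : (0 < k)%N -> (k <= M)%N ->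
  1 + ln (M%:R / k%:R) <= 2 * ln (4 * (M %/ k)%N%:R) :> R.
Proof.
move=> k0 kM; set N := (M %/ k)%N.
have N0 : (0 < N)%N by rewrite divn_gt0.
have kR : 0 < k%:R :> R by rewrite ltr0n.
have NR : 1 <= N%:R :> R by rewrite ler1n.
have MR : 0 < M%:R :> R by rewrite ltr0n (leq_trans k0).
(* This is [ln (1 + x) <= x] at [x = - 1 / 2]. *)
have ln2 : 1 / 2 <= ln 2 :> R.
  have := @le_ln1Dx R (- (1 / 2)).
  rewrite (_ : 1 + - (1 / 2) = 2^-1); last by field.
  rewrite lnV ?posrE//; lra.
have le2N : ln (M%:R / k%:R) <= ln (2 * N%:R) :> R.
  rewrite ler_ln ?posrE ?divr_gt0 ?mulr_gt0//; last lra.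
  rewrite ler_pdivrMr// -!natrM ler_nat (leq_trans (ltnW (ltn_ceil M k0)))//.
  by rewrite leq_mul2r -/N; apply/orP; right; lia.
have -> : 4 * N%:R = 2 * (2 * N%:R) :> R by ring.
rewrite lnM ?posrE//; last lra.
have : ln 2 <= ln (2 * N%:R) :> R by rewrite ler_ln ?posrE//; lra.
lra.
Qed.

(** * Application to stationary correlations on the torus *)

Lemma torus_minimax_risk_ge d (Omega : measurableType d) (R : realType)
    (P : probability Omega R) (p : nat) (X : 'I_p -> {RV P >-> R})
    (eps : {RV P >-> R}) (sigma : R) (n k m : nat) :
  0 < sigma -> gaussian_linear_model X eps sigma -> (0 < n)%N -> (0 < k)%N ->
  (0 < m)%N -> k%:R < p%:R / m%:R :> R ->
  (forall i, corrmx X i i = 1) ->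
  (forall i j, (m <= torus_dist i j)%N -> `|corrmx X i j| <= (4 * k%:R)^-1) ->
  ((4096^-1 * (k%:R * sigma ^+ 2 / n%:R) *
    (1 + ln ((Num.floor (p%:R * m%:R^-1 : R))%:~R / k%:R)))%:E
    <= minimax_risk X eps n k)%E.
Proof.
move=> s0 [_ mean0 _ geps indep] n0 k0 m0 kpm corr1 corr_small.
rewrite floor_divn//; set M := (p %/ m)%N.
have kM : (k <= M)%N.
  by rewrite leq_divRL// ltnW// -(@ltr_nat R) natrM -ltr_pdivlMr// ltr0n.
pose N := (M %/ k)%N.
have kNm : (k * N * m <= p)%N.
  by rewrite -leq_divRL// mulnC /N leq_trunc_div.
apply: le_trans (minimax_risk_ge (f := grid m0 kNm) s0 geps indep mean0 corr1
  n0 k0 _ _); last 2 first.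
- by rewrite divn_gt0.
- by move=> a a' aa'; apply: corr_small; exact: torus_dist_grid.
rewrite lee_fin.
have := ln_ratio_le R k0 kM; rewrite -/N => le_ln.
have c0 : 0 <= k%:R * sigma ^+ 2 / n%:R.
  by rewrite divr_ge0// mulr_ge0// sqr_ge0.
move: (k%:R * sigma ^+ 2 / n%:R) c0 => c c0.
(* The factor [2] of [ln_ratio_le] turns [2048] into [4096]. *)
rewrite (_ : c * _ / 2048 = 4096^-1 * c * (2 * ln (4 * N%:R))); last by field.
have K0 : 0 <= 4096^-1 :> R by rewrite invr_ge0 ler0n.
exact: (ler_wpM2l (mulr_ge0 K0 c0) le_ln).
Qed.

(** In both cases [m] is the least integer distance at which the prescribed correlation is at most
    [1 / (4 * k)]. *)
Theorem proposition4p6 (R : realType) :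
  exists L : R, 0 < L /\
  forall (d : measure_display) (Omega : measurableType d)
    (P : probability Omega R) (p : nat) (X : 'I_p -> {RV P >-> R})
    (eps : {RV P >-> R}) (sigma : R) (n k : nat),
  0 < sigma -> gaussian_linear_model X eps sigma -> (0 < n)%N -> (0 < k)%N ->
  (forall omega : R, 0 < omega -> corrmx X = Psi1 p omega ->
    let m : R := (Num.ceil (ln (4 * k%:R) / omega))%:~R in
    k%:R < p%:R / m ->
    ((L * (k%:R * sigma ^+ 2 / n%:R) *
      (1 + ln ((Num.floor (p%:R * m^-1))%:~R / k%:R)))%:E
      <= minimax_risk X eps n k)%E)
  /\
  (forall t : R, 0 < t -> corrmx X = Psi2 p t ->
    let m : R := (Num.ceil ((4 * k%:R) `^ t^-1 - 1))%:~R in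
    k%:R < p%:R / m ->
    ((L * (k%:R * sigma ^+ 2 / n%:R) *
      (1 + ln ((Num.floor (p%:R * m^-1))%:~R / k%:R)))%:E
      <= minimax_risk X eps n k)%E).
Proof.
(* As [4 * k > 1], both arguments of the upper integer part are positive, so it is a positive
   natural number. *)
have ceil_nat (x : R) : 0 < x ->
    exists2 m : nat, (0 < m)%N & Num.ceil x = m%:Z /\ x <= m%:R.
  rewrite -ceil_gt0; case cx : (Num.ceil x) => [m|//] m0.
  by exists m => //; split=> //; have := ceil_ge x; rewrite cx -pmulrn.
exists 4096^-1; split; first by rewrite invr_gt0 ltr0n.
move=> d Omega P p X eps sigma n k s0 model n0 k0.
have k1 : 1 <= k%:R :> R by rewrite ler1n.
have k4 : 0 < 4 * k%:R :> R by lra.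
split=> [omega o0 corrE|t t0 corrE].
  have x0 : 0 < ln (4 * k%:R) / omega by rewrite divr_gt0// ln_gt0//; lra.
  have [m m0 [-> xm]] := ceil_nat _ x0.
  move=> /= kpm; apply: torus_minimax_risk_ge => // [i|i j ij].
    by rewrite corrE mxE torus_distii mulr0 expR0.
  rewrite corrE mxE ger0_norm ?expR_ge0// -[leRHS]lnK ?posrE ?invr_gt0//.
  rewrite ler_expR lnV ?posrE// mulNr lerN2 [omega * _]mulrC -ler_pdivrMr//.
  by rewrite (le_trans xm)// ler_nat.
have x0 : 0 < (4 * k%:R) `^ t^-1 - 1 :> R.
  rewrite subr_gt0 -[ltLHS](_ : 1 `^ t^-1 = 1); last by rewrite powR1.
  by apply: gt0_ltr_powR; rewrite ?invr_gt0 ?nnegrE ?(ltW k4)//; lra.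
have [m m0 [-> xm]] := ceil_nat _ x0.
move=> /= kpm; apply: torus_minimax_risk_ge => // [i|i j ij].
  by rewrite corrE mxE torus_distii addr0 powR1.
rewrite corrE mxE ger0_norm ?powR_ge0// powRN.
rewrite lef_pV2 ?posrE ?powR_gt0// ?ltr_wpDr//.
(* Once [4 * k] is a power of exponent [t], it suffices to compare the bases. *)
have {1}-> : 4 * k%:R = ((4 * k%:R) `^ t^-1) `^ t :> R.
  by rewrite -powRrM mulVf ?gt_eqF// powRr1// ltW.
have mij : m%:R <= (torus_dist i j)%:R :> R by rewrite ler_nat.
apply: ge0_ler_powR; rewrite ?nnegrE ?powR_ge0 ?(ltW t0)//; lra.
Qed.
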